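(* Fix an integer $d \geq 1$. Each of the following compact subgroups $G \leq U_d$ has the quadrature property: (1) the group $U_d$ of all $d \times d$ unitary matrices; (2) the group $O_d$ of all $d \times d$ real orthogonal matrices; (3) for each $s \in \{2,3,4,\ldots\} \cup \{\infty\}$, the group $H_d^s$ of all $d \times d$ matrices of the form $DP$, where $P$ is a $d \times d$ permutation matrix and $D$ is a diagonal matrix whose diagonal entries are $s$-th roots of unity (when $s < \infty$) or arbitrary complex numbers of modulus $1$ (when $s = \infty$). (For $s=2$ this is the group of $d \times d$ signed permutation matrices.)
   Context: For $1 \leq i,j \leq d$, $u_{ij}$ denotes the function picking out the $(i,j)$-th entry of a matrix, and integrals $\int_G \cdots \, dU$ are with respect to the Haar probability measure of $G$. For $k \geq 0$, $S_k$ is the symmetric group on $[k]=\{1,\ldots,k\}$ and $\mathrm{sgn}$ is the sign of a permutation. A compact subgroup $G \leq U_d$ is said to have the quadrature property if for every integer $0 \leq k \leq d$ and every map $\mathbf{p} : [k] \to [d]$, \[ \sum_{\sigma \in S_k} \mathrm{sgn}(\sigma) \int_G \prod_{i=1}^k u_{i \mathbf{p}(i)} \overline{u_{\sigma(i) \mathbf{p}(i)}} \, dU = \begin{cases} \frac{(d-k)!}{d!} & \text{if } \mathbf{p} \text{ is injective,} \\ 0 & \text{otherwise.} \end{cases} \] *)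

(* Defs.v *)
From HB Require Import structures.
From mathcomp Require Import all_boot all_order all_algebra all_fingroup.
From mathcomp Require Import spectral complex.
From mathcomp Require Import all_classical all_reals all_analysis.
Set Implicit Arguments.
Unset Strict Implicit.
Unset Printing Implicit Defensive.
Import Order.TTheory GRing.Theory Num.Theory.
Import numFieldNormedType.Exports.
Local Open Scope classical_set_scope.
Local Open Scope complex_scope.
Local Open Scope ring_scope.

(* R[i] packed as a numClosedFieldType: this head constant is what gives it the
   topology of its norm (which MathComp-Analysis attaches to abstract number
   fields, not to R[i]), hence 'M[Cplx R]_d the entrywise topology. *)
Definition Cplx (R : realType) : numClosedFieldType := R[i].

Definition borelMx (R : realType) (d : nat) :=
  g_sigma_algebraType (@open 'M[Cplx R]_d).

(* Both parts must be integrable for this to be the integral of f;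
   [Rintegral] is total. *)
Definition Cintegral (dT : measure_display) (T : measurableType dT)
    (R : realType) (mu : {measure set T -> \bar R}) (D : set T)
    (f : T -> Cplx R) : Cplx R :=
  (\int[mu]_(x in D) complex.Re (f x : R[i])) +i*
  (\int[mu]_(x in D) complex.Im (f x : R[i])).

Definition unitary_group (R : realType) (d : nat) : set 'M[Cplx R]_d :=
  [set U | U \is unitarymx].
Arguments unitary_group R d : clear implicits.

Definition orthogonal_group (R : realType) (d : nat) : set 'M[Cplx R]_d :=
  [set map_mx (real_complex R) A | A in [set A : 'M[R]_d | A *m A^T = 1%:M]].
Arguments orthogonal_group R d : clear implicits.

(* [None] stands for s = oo. *)
Definition roots_of_unity (R : realType) (s : option nat) : set (Cplx R) :=
  if s is Some n then [set z | z ^+ n = 1] else [set z | `|z| = 1].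
Arguments roots_of_unity R s : clear implicits.

Definition hyperoctahedral_group (R : realType) (d : nat) (s : option nat) :
    set 'M[Cplx R]_d :=
  [set U | exists (D : 'rV[Cplx R]_d) (t : 'S_d),
     (forall j, roots_of_unity R s (D 0 j)) /\ U = diag_mx D *m perm_mx t].
Arguments hyperoctahedral_group R d s : clear implicits.

Definition compact_unitary_subgroup (R : realType) (d : nat)
    (G : set 'M[Cplx R]_d) : Prop :=
  [/\ compact G, G `<=` unitary_group R d, G 1%:M,
      (forall U V, G U -> G V -> G (U *m V)) &
      (forall U, G U -> G (invmx U))].

(* A Borel probability measure on G is encoded as one on the ambient matrix
   space giving mass 1 to G. Left invariance suffices: on a compact group it
   characterises the Haar probability measure, and finite Borel measures on a
   compact metric space are regular. *)
Definition haar_probability (R : realType) (d : nat) (G : set 'M[Cplx R]_d)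
    (mu : probability (borelMx R d) R) : Prop :=
  mu G = 1%E /\
  forall U : 'M[Cplx R]_d, G U ->
  forall A : set (borelMx R d), measurable A ->
    mu ((fun V : 'M[Cplx R]_d => U *m V) @^-1` A) = mu A.

Definition quadrature_property (R : realType) (d : nat)
    (G : set 'M[Cplx R]_d) : Prop :=
  compact_unitary_subgroup G /\
  forall mu : probability (borelMx R d) R, haar_probability G mu ->
  forall (k : nat) (hk : (k <= d)%N) (p : 'I_k -> 'I_d),
    \sum_(sigma : 'S_k) (-1) ^+ sigma *
      Cintegral mu G (fun U : 'M[Cplx R]_d =>
        \prod_(i < k) (U (widen_ord hk i) (p i) *
                       (U (widen_ord hk (sigma i)) (p i))^*))
    = if injectiveb p then ((d - k)`!)%:R / (d`!)%:R else 0.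

(* Main.v *)
Require Import Defs.
From mathcomp Require Import all_boot all_order all_algebra all_reals.
From mathcomp Require Import all_fingroup spectral complex.
From mathcomp Require Import all_classical all_analysis measurable_realfun.

(* Only two properties of G matter: it consists of unitary matrices and it
   contains the permutation matrices P_t, t in S_d.  The signed sum of the
   integrands is f(U) = prod_i U_{i,p(i)} * conj(det U_{[k],p}), which vanishes
   identically when p is not injective.  When p is injective, the translates
   f(P_t U) involve the restriction of t to [k], each injection [k] -> [d] being
   hit (d-k)! times; non-injective row choices contribute zero minors, so the sum
   over t equals (d-k)! times a sum over all maps [k] -> [d], which factors through
   the orthonormality of the columns of U and equals 1.  By left invariance,
   d! times the integral of f is therefore (d-k)!. *)

Set Implicit Arguments.
Unset Strict Implicit.
Unset Printing Implicit Defensive.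
Import Order.TTheory GRing.Theory Num.Theory numFieldNormedType.Exports.
Local Open Scope ring_scope.

(** * The alternating sum on unitary matrices *)

(** The values of [a], followed by the indices that [a] misses, list all of ['I_d] without
    repetition; reading this list by position is the required permutation. *)
Lemma perm_extends_inj (k d : nat) (hk : (k <= d)%N) (a : 'I_k -> 'I_d) :
  injective a -> exists t : 'S_d, forall i, t (widen_ord hk i) = a i.
Proof.
move=> a_inj; pose s := codom a ++ [seq x <- enum 'I_d | x \notin codom a].
have s_uniq : uniq s.
  rewrite cat_uniq filter_uniq ?enum_uniq // andbT map_inj_uniq ?enum_uniq //=.
  by apply/hasPn => x; rewrite mem_filter => /andP[].
have s_size : size s = d.
  have /perm_size-> : perm_eq s (enum 'I_d); last by rewrite size_enum_ord.
  apply: uniq_perm => //; first exact: enum_uniq.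
  by move=> x; rewrite mem_cat mem_filter mem_enum andbT inE /= orbN.
(* The default [i] of [nth] varies with the index, but it is never reached because [s] has size
   [d]. *)
have t_inj : injective (fun i : 'I_d => nth i s i).
  move=> i j; rewrite (set_nth_default j) ?s_size // => /eqP.
  by rewrite nth_uniq ?s_size // => /eqP/val_inj.
exists (perm t_inj) => i; rewrite permE nth_cat size_codom card_ord /= ltn_ord.
by rewrite codomE (nth_map i) ?nth_ord_enum // size_enum_ord.
Qed.

(** Once one extension [t0] is chosen, the others are the products [u * t0] with [u] fixing the
    first [k] indices, so they form a coset of the symmetric group on the remaining [d - k]
    points. *)
Lemma card_perm_extending (k d : nat) (hk : (k <= d)%N) (a : 'I_k -> 'I_d) :
  injective a ->
  #|[pred t : 'S_d | [forall i, t (widen_ord hk i) == a i]]| = (d - k)`!.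
Proof.
move=> /(perm_extends_inj hk)[t0 t0E].
pose B : {set 'I_d} := [set x : 'I_d | (k <= x)%N].
have cardB : #|B| = (d - k)%N.
  transitivity (\sum_(k <= i < d) 1)%N; last by rewrite sum_nat_const_nat muln1.
  by rewrite big_geq_mkord sum1dep_card; apply: eq_card => x; rewrite !inE.
rewrite -cardB -card_perm -[in RHS](card_imset _ (@mulIg _ t0)) //.
apply: eq_card => t; rewrite inE; apply/forallP/imsetP => [tE|[u uB ->{t}] i].
  exists (t * t0^-1)%g; last by rewrite mulgKV.
  apply/fintype.subsetP => x; rewrite !inE; apply: contraR; rewrite -ltnNge => xk.
  have -> : x = widen_ord hk (Ordinal xk) by apply: val_inj.
  by rewrite permM (eqP (tE _)) -t0E permK.
by rewrite permM (out_perm uB) ?t0E // inE -ltnNge /=.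
Qed.

Section PermutationSum.
Variables (C : numClosedFieldType) (k d : nat).
Implicit Types (U : 'M[C]_d) (p a : 'I_k -> 'I_d).

(* The signed sum is [prod_i U (a i) (p i)] times the conjugate of the minor of [U]
   on rows [a] and columns [p]. *)
Definition alternating_product U p a : C :=
  \sum_(s : 'S_k) (-1) ^+ s * \prod_(i < k) (U (a i) (p i) * (U (a (s i)) (p i))^*).

Lemma alternating_productE U p a :
  alternating_product U p a =
  (\prod_(i < k) U (a i) (p i)) * \det (\matrix_(i, j) (U (a j) (p i))^*).
Proof.
rewrite /determinant mulr_sumr; apply: eq_bigr => s _.
rewrite big_split mulrCA; congr (_ * (_ * _)).
by apply: eq_bigr => i _; rewrite mxE.
Qed.

Lemma alternating_product_eq0_col U p a i j :
  i != j -> p i = p j -> alternating_product U p a = 0.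
Proof.
move=> ij pij; rewrite alternating_productE (determinant_alternate ij) ?mulr0 //.
by move=> l; rewrite !mxE pij.
Qed.

Lemma alternating_product_eq0_row U p a i j :
  i != j -> a i = a j -> alternating_product U p a = 0.
Proof.
move=> ij aij; rewrite alternating_productE -det_tr (determinant_alternate ij) ?mulr0 //.
by move=> l; rewrite !mxE aij.
Qed.

Lemma unitarymx_colE U (x y : 'I_d) : U \is unitarymx ->
  \sum_r U r x * (U r y)^* = (x == y)%:R.
Proof.
rewrite -trmxC_unitary => /unitarymxP /(congr1 (fun M : 'M[C]_d => M y x)).
rewrite trmxCK !mxE eq_sym => <-.
by apply: eq_bigr => r _; rewrite !mxE mulrC.
Qed.

(** After exchanging the sums, the sum over all maps [a] factors, for each fixed [s], into a product
    over [i] of inner products of columns of [U]. By orthonormality and injectivity of [p], only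
    [s = 1] survives. *)
Lemma sum_alternating_product U p : U \is unitarymx -> injective p ->
  \sum_(a : {ffun 'I_k -> 'I_d}) alternating_product U p a = 1.
Proof.
move=> Uu p_inj; rewrite exchange_big (bigD1 1%g) //= [X in _ + X]big1 ?addr0.
  under eq_bigr do (rewrite odd_perm1 expr0 mul1r; under eq_bigr do rewrite perm1).
  rewrite -(bigA_distr_bigA (fun i r => U r (p i) * (U r (p i))^*)) big1 // => i _.
  by rewrite unitarymx_colE // eqxx.
move=> s s1; rewrite -big_distrr.
(* Reindexing the conjugated factors by [s^-1] makes the [i]-th factor depend on [a] through [a i]
   alone, as factoring requires. *)
have -> : \sum_(a : {ffun 'I_k -> 'I_d})
    \prod_(i < k) (U (a i) (p i) * (U (a (s i)) (p i))^*) =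
  \sum_(a : {ffun 'I_k -> 'I_d})
    \prod_(i < k) (U (a i) (p i) * (U (a i) (p ((s^-1)%g i)))^*).
  apply: eq_bigr => a _; rewrite !big_split; congr (_ * _).
  by rewrite [RHS](reindex_inj (@perm_inj _ s)); apply: eq_bigr => i _; rewrite permK.
rewrite -(bigA_distr_bigA (fun i r => U r (p i) * (U r (p ((s^-1)%g i)))^*)).
have [i si] : exists i, s i != i.
  apply/existsP; apply: contraNT s1 => /existsPn sE; apply/eqP/permP => i.
  by rewrite perm1; apply/eqP; rewrite -[_ == _]negbK sE.
(* The factor at index [s i] pairs the columns [p (s i)] and [p i], which are distinct and hence
   orthogonal. *)
rewrite (bigD1 (s i)) //= unitarymx_colE // permK (inj_eq p_inj) (negbTE si).
by rewrite mul0r mulr0.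
Qed.

(** Permutations are grouped by their restriction to the first [k] indices, which turns the sum into
    [(d - k)!] times the sum over all maps. *)
Lemma sum_perm_alternating_product U p (hk : (k <= d)%N) :
  U \is unitarymx -> injective p ->
  \sum_(t : 'S_d) alternating_product U p (fun i => t (widen_ord hk i))
  = ((d - k)`!)%:R.
Proof.
move=> Uu p_inj.
pose r (t : 'S_d) := [ffun i => t (widen_ord hk i)].
rewrite (partition_big r xpredT) //=.
rewrite -[RHS]mulr1 -[X in _ * X](sum_alternating_product Uu p_inj) mulr_sumr.
apply: eq_bigr => a _.
have [/injectiveP a_inj|] := boolP (injectiveb a); last first.
  (* The fibre over a non-injective [a] is empty, but it suffices that any term in it would have two
     equal rows. *)
  case/injectivePn => i [j ij aij]; rewrite (alternating_product_eq0_row _ _ ij aij).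
  rewrite mulr0 big1 // => t /eqP ta; apply: (alternating_product_eq0_row _ _ ij).
  move/ffunP: ta => ta; rewrite -[LHS](ffunE (fun i => t (widen_ord hk i))).
  by rewrite ta aij -ta ffunE.
rewrite -(card_perm_extending hk a_inj). rewrite mulr_natl -sumr_const.
apply: eq_big => [t|t /eqP ta].
  rewrite inE; apply/eqP/forallP => [<- i|tE]; first by rewrite ffunE.
  by apply/ffunP => i; rewrite ffunE; apply/eqP.
apply: eq_bigr => s _; congr (_ * _); apply: eq_bigr => i _.
by rewrite -ta !ffunE.
Qed.
End PermutationSum.

(** The squared modulus of the entry is one of the nonnegative terms whose sum is the squared norm
    of a unit row. *)
Lemma unitarymx_entry_le1 (C : numClosedFieldType) (d : nat) (U : 'M[C]_d) i j :
  U \is unitarymx -> `|U i j| <= 1.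
Proof.
move=> /unitarymxP /(congr1 (fun M : 'M[C]_d => M i i)); rewrite !mxE eqxx /= => Uii.
rewrite -(@expr_le1 _ 2) // -[leRHS]Uii (bigD1 j) //= !mxE -normCK lerDl.
by apply: sumr_ge0 => l _; rewrite !mxE -normCK exprn_ge0.
Qed.

Lemma perm_mx_unitary (C : numClosedFieldType) (d : nat) (t : 'S_d) :
  (perm_mx t : 'M[C]_d) \is unitarymx.
Proof. by apply/unitarymxP; rewrite tr_perm_mx map_perm_mx -perm_mxM mulgV perm_mx1. Qed.

Local Open Scope classical_set_scope.
Local Open Scope complex_scope.
Local Open Scope sesquilinear_scope.
Local Open Scope ring_scope.

(** * Topology of complex matrices *)

Lemma continuous_add (K : numFieldType) (T : topologicalType) (f g : T -> K) :
  continuous f -> continuous g -> continuous (fun x => f x + g x).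
Proof. by move=> cf cg x; exact: cvgD (cf x) (cg x). Qed.

Lemma continuous_mul (K : numFieldType) (T : topologicalType) (f g : T -> K) :
  continuous f -> continuous g -> continuous (fun x => f x * g x).
Proof. by move=> cf cg x; exact: cvgM (cf x) (cg x). Qed.

Lemma continuous_sum (K : numFieldType) (T : topologicalType) (I : Type) (r : seq I)
    (P : pred I) (f : I -> T -> K) :
  (forall i, P i -> continuous (f i)) -> continuous (fun x => \sum_(i <- r | P i) f i x).
Proof.
move=> cf; elim: r => [|i r IH].
  by under eq_fun do rewrite big_nil; move=> x; exact: cvg_cst.
under eq_fun do rewrite big_cons; case: (boolP (P i)) => // Pi x.
exact: cvgD (cf i Pi x) (IH x).
Qed.

Lemma continuous_prod (K : numFieldType) (T : topologicalType) (I : Type) (r : seq I)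
    (P : pred I) (f : I -> T -> K) :
  (forall i, P i -> continuous (f i)) -> continuous (fun x => \prod_(i <- r | P i) f i x).
Proof.
move=> cf; elim: r => [|i r IH].
  by under eq_fun do rewrite big_nil; move=> x; exact: cvg_cst.
under eq_fun do rewrite big_cons; case: (boolP (P i)) => // Pi x.
exact: cvgM (cf i Pi x) (IH x).
Qed.

(** A neighbourhood of a matrix contains a product of neighbourhoods of its entries, and finitely
    many such conditions hold together near [x]. *)
Lemma mx_continuous (K : numFieldType) (T : topologicalType) (m n : nat)
    (f : T -> 'M[K]_(m, n)) :
  (forall i j, continuous (fun x => f x i j)) -> continuous f.
Proof.
move=> cf x A [P xP sPA].
have : \forall y \near x, forall ij : 'I_m * 'I_n, P ij.1 ij.2 (f y ij.1 ij.2).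
  by apply: filter_forall => -[i j]; exact: cf (xP i j).
by apply: filterS => y yP; apply: sPA => i j; exact: (yP (i, j)).
Qed.

Lemma mulmxl_continuous (K : numFieldType) (m n p : nat) (A : 'M[K]_(m, n)) :
  continuous (fun B : 'M[K]_(n, p) => A *m B).
Proof.
apply: mx_continuous => i j; under eq_fun do rewrite mxE.
apply: continuous_sum => l _ B.
exact: (cvgM (cvg_cst _) (@coord_continuous _ _ _ l j B)).
Qed.

(** The compactness of products of compact sets, known for row vectors, is carried over by the
    continuous map [vec_mx]. *)
Lemma compact_mx (K : numFieldType) (m n : nat) (A : set K) :
  compact A -> compact [set M : 'M[K]_(m, n) | forall i j, A (M i j)].
Proof.
move=> cA; have := @rV_compact K (m * n) (fun=> A) (fun=> cA).
have cvec : continuous (@vec_mx K m n).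
  apply: mx_continuous => i j; under eq_fun do rewrite mxE; exact: coord_continuous.
move/(continuous_compact (continuous_subspaceT cvec)).
congr compact; apply/seteqP; split => [_ [v Av <-] i j|M AM]; first by rewrite mxE.
exists (mxvec M); last by rewrite mxvecK.
by move=> i; case/mxvec_indexP: i => i j; rewrite mxvecE.
Qed.

Section CplxTopology.
Variable R : realType.

Lemma Re_continuous : continuous (fun z : Cplx R => complex.Re (z : R[i])).
Proof.
(* Balls of [Cplx R] have radii in [Cplx R] itself, so the real radius [e] has to be embedded. *)
move=> z A /= /nbhs_ballP[e /= e0 eA]; apply/nbhs_ballP; exists (e%:C : Cplx R).
  by rewrite /= ltcR.
move=> w zw; apply: eA; rewrite /ball /= -ltcR -raddfB.
exact: le_lt_trans (normc_ge_Re _) zw.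
Qed.

Lemma conj_continuous : continuous (fun z : Cplx R => z^* ).
Proof.
move=> z A /= /nbhs_ballP[e /= e0 eA]; apply/nbhs_ballP; exists e => // w zw.
by apply: eA; rewrite /ball /= -rmorphB /= norm_conjC.
Qed.

Lemma real_complex_continuous : continuous (real_complex R : R -> Cplx R).
Proof.
(* A positive element of [Cplx R] has zero imaginary part, so the real part of the radius [e] serves
   as radius in [R]. *)
move=> x A /= /nbhs_ballP[e /=]; rewrite {1}ltcE /= => /andP[/eqP ime e0] eA.
apply/nbhs_ballP; exists (complex.Re (e : R[i])) => // y xy; apply: eA.
by rewrite /ball /= -rmorphB /= normc_def ltcE /= ime eqxx /= expr0n addr0 sqrtr_sqr.
Qed.

Lemma Im_continuous : continuous (fun z : Cplx R => complex.Im (z : R[i])).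
Proof.
(* The identity Im z = Re (-i z) reduces the claim to the continuity of the real part. *)
have -> : (fun z : Cplx R => complex.Im (z : R[i])) =
    (fun z => complex.Re ((- 'i%C : Cplx R) * z : R[i])).
  by apply/funext => -[a b] /=; rewrite oppr0 mul0r sub0r mulN1r opprK.
move=> z; apply: (@continuous_comp _ _ _ (fun z : Cplx R => (- 'i%C : Cplx R) * z)).
  exact: mulrl_continuous.
exact: Re_continuous.
Qed.

(** This is the image of the real square with sides [[-1, 1]] under (x, y) -> x + iy. It contains
    every entry of every unitary matrix. *)
Lemma compact_unit_square :
  compact [set z : Cplx R | `|complex.Re (z : R[i])| <= 1 /\ `|complex.Im (z : R[i])| <= 1].
Proof.
pose f (x : R * R) : Cplx R := real_complex R x.1 + ('i%C : Cplx R) * real_complex R x.2.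
have cf : continuous f.
  apply: continuous_add => [x|].
    by apply: (@continuous_comp _ _ _ fst (real_complex R : R -> Cplx R));
      [exact: cvg_fst|exact: real_complex_continuous].
  apply: continuous_mul => x; first exact: cvg_cst.
  by apply: (@continuous_comp _ _ _ snd (real_complex R : R -> Cplx R));
    [exact: cvg_snd|exact: real_complex_continuous].
have fE a b : f (a, b) = a +i* b by rewrite /f [RHS]complexE.
have := compact_setX (@segment_compact R (-1) 1) (@segment_compact R (-1) 1).
move/(continuous_compact (continuous_subspaceT cf)).
congr compact; apply/seteqP; split => [_ [[a b] /= [a1 b1] <-]|[a b] /= [a1 b1]].
  by move: a1 b1; rewrite fE /= !in_itv /= -!ler_norml.
by exists (a, b); rewrite ?fE //= !in_itv /= -!ler_norml.
Qed.

Lemma normc_ge_Im (z : R[i]) : `|complex.Im z|%:C <= `|z|.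
Proof.
rewrite -[X in _ <= `|X|]mul1r.
have -> : complex.Im z = complex.Re (- 'i%C * z).
  by case: z => a b /=; rewrite oppr0 mul0r sub0r mulN1r opprK.
apply: le_trans (normc_ge_Re _) _; rewrite !normrM normrN.
by rewrite [X in X * _]normc_def /= expr0n add0r expr1n sqrtr1 normr1.
Qed.

Lemma closed_set1 (x : Cplx R) : closed [set x].
Proof. exact/accessible_closed_set1/hausdorff_accessible/norm_hausdorff. Qed.

(** Orthonormality of the rows amounts to finitely many equations between continuous functions of
    the entries. *)
Lemma closed_unitary_group (d : nat) : closed (unitary_group R d).
Proof.
have -> : unitary_group R d = \bigcap_(ij in [set: 'I_d * 'I_d])
    [set U | \sum_l U ij.1 l * (U ij.2 l)^* = (ij.1 == ij.2)%:R].
  apply/seteqP; split => [U /unitarymxP UU [i j] _|U UU].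
    move/(congr1 (fun M : 'M[Cplx R]_d => M i j)): UU; rewrite !mxE /= => <-.
    by apply: eq_bigr => l _; rewrite !mxE.
  apply/unitarymxP/matrixP => i j; rewrite !mxE -(UU (i, j) I).
  by apply: eq_bigr => l _; rewrite !mxE.
apply: closed_bigI => -[i j] _ /=.
apply: (@preimage_closed _ _ (fun U : 'M[Cplx R]_d => \sum_l U i l * (U j l)^*)
  [set (i == j)%:R]); last exact: closed_set1.
move=> U _; apply: continuous_sum => l _ {}U.
apply: (cvgM (@coord_continuous _ _ _ i l U)).
apply: (@continuous_comp _ _ _ (fun U : 'M[Cplx R]_d => U j l) (fun z => z^* )).
  exact: coord_continuous.
exact: conj_continuous.
Qed.

(** A Heine-Borel argument: the group is closed and lies among the matrices with entries in the
    compact unit square. *)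
Lemma compact_unitary_group (d : nat) : compact (unitary_group R d).
Proof.
apply: subclosed_compact (compact_mx compact_unit_square) _.
  exact: closed_unitary_group.
move=> U Uu i j; have Uij := unitarymx_entry_le1 i j Uu.
by split; rewrite -lecR; [apply: le_trans (normc_ge_Re _) Uij|
  apply: le_trans (normc_ge_Im _) Uij].
Qed.

End CplxTopology.

(** * Integration against the Haar probability *)

Section HaarIntegral.
Variables (R : realType) (d : nat) (G : set 'M[Cplx R]_d).
Variable mu : probability (borelMx R d) R.
Hypotheses (G_compact : compact G) (haar : haar_probability G mu).
Implicit Types f g : 'M[Cplx R]_d -> Cplx R.

Lemma measurable_compact_borelMx : measurable (G : set (borelMx R d)).
Proof.
rewrite -[G]setCK; apply: measurableC; apply: sub_sigma_algebra.
apply: closed_openC; apply: compact_closed G_compact.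
exact: (@norm_hausdorff (Cplx R) 'M[Cplx R]_d).
Qed.

Lemma continuous_measurable_borelMx (f : 'M[Cplx R]_d -> R) :
  continuous f -> measurable_fun setT (f : borelMx R d -> R).
Proof.
move=> /continuousP cf; apply: (measurability _ (RGenOpens.measurableE R)).
move=> _ [_ [a [b ->] <-]]; rewrite setTI; apply: sub_sigma_algebra.
exact/cf/interval_open.
Qed.

(** A continuous function is bounded on the compact set [G], whose mass is finite. Since [Rintegral]
    is total, this is what gives the integrals below their meaning and makes them additive. *)
Lemma continuous_integrable_borelMx (f : 'M[Cplx R]_d -> R) :
  continuous f -> mu.-integrable (G : set (borelMx R d)) (EFin \o f).
Proof.
move=> cf; apply: measurable_bounded_integrable.
- exact: measurable_compact_borelMx.
- by apply: le_lt_trans (ltry 1); exact: probability_le1 measurable_compact_borelMx.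
- by apply: measurable_funTS; exact: continuous_measurable_borelMx.
have /compact_bounded[M [_ mrt]] :=
  continuous_compact (continuous_subspaceT (cf : continuous (f : _ -> R^o))) G_compact.
by exists M; split; rewrite ?num_real // => ? ? ? ?; exact: mrt.
Qed.

Lemma CintegralD f g : continuous f -> continuous g ->
  Cintegral mu G (fun U => f U + g U) = Cintegral mu G f + Cintegral mu G g.
Proof.
have cRe (h : 'M[Cplx R]_d -> Cplx R) : continuous h ->
    continuous (fun U => complex.Re (h U : R[i])).
  by move=> ch U; apply: continuous_comp; [exact: ch|exact: Re_continuous].
have cIm (h : 'M[Cplx R]_d -> Cplx R) : continuous h ->
    continuous (fun U => complex.Im (h U : R[i])).
  by move=> ch U; apply: continuous_comp; [exact: ch|exact: Im_continuous].
move=> cf cg; rewrite /Cintegral.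
under eq_Rintegral do rewrite raddfD.
under [X in _ +i* X]eq_Rintegral do rewrite raddfD.
have mG := measurable_compact_borelMx.
rewrite (RintegralD mG (continuous_integrable_borelMx (cRe f cf))
  (continuous_integrable_borelMx (cRe g cg))).
by rewrite (RintegralD mG (continuous_integrable_borelMx (cIm f cf))
  (continuous_integrable_borelMx (cIm g cg))).
Qed.

Lemma Cintegral_cst c : Cintegral mu G (fun=> c) = c.
Proof.
rewrite /Cintegral !Rintegral_cst; try exact: measurable_compact_borelMx.
have -> : (mu : {measure set (borelMx R d) -> \bar R}) G = 1%E := haar.1.
by rewrite /= !mulr1; case: c.
Qed.

(** Signs are the only scalars in the quadrature sum. The case of -1 follows from additivity, since
    f + (-f) integrates to 0. *)
Lemma CintegralMsign f b : continuous f ->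
  Cintegral mu G (fun U => (-1) ^+ (b : bool) * f U) = (-1) ^+ b * Cintegral mu G f.
Proof.
case: b => cf; last first.
  by rewrite expr0 mul1r; under eq_fun do rewrite mul1r.
rewrite expr1 mulN1r; under eq_fun do rewrite mulN1r.
have cNf : continuous (fun U => - f U) by move=> U; exact: cvgN (cf U).
apply: (addrI (Cintegral mu G f)); rewrite -(CintegralD cf cNf) subrr.
by under eq_fun do rewrite subrr; exact: Cintegral_cst.
Qed.

Lemma Cintegral_sum (I : Type) (r : seq I) (P : pred I) (F : I -> 'M[Cplx R]_d -> Cplx R) :
  (forall i, continuous (F i)) ->
  Cintegral mu G (fun U => \sum_(i <- r | P i) F i U) =
  \sum_(i <- r | P i) Cintegral mu G (F i).
Proof.
move=> cF; elim: r => [|i r IH].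
  by under eq_fun do rewrite big_nil; rewrite Cintegral_cst big_nil.
rewrite big_cons; under eq_fun do rewrite big_cons.
case: (P i) => //; rewrite CintegralD ?IH //.
by apply: continuous_sum => j _.
Qed.

Lemma eq_Cintegral f g : (forall U, G U -> f U = g U) ->
  Cintegral mu G f = Cintegral mu G g.
Proof.
by move=> fg; congr (_ +i* _); apply: eq_Rintegral => U; rewrite inE => /fg->.
Qed.

(** Invariance passes from sets to functions through the pushforward of [mu] by left multiplication
    by [A], which agrees with [mu] on measurable sets; the domain [G] is its own preimage. *)
Lemma Cintegral_mulmxl f A : continuous f -> G A ->
  (forall U, G (A *m U) <-> G U) ->
  Cintegral mu G (fun U => f (A *m U)) = Cintegral mu G f.
Proof.
move=> cf GA GAU; pose phi (U : borelMx R d) : borelMx R d := A *m U.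
have mphi : measurable_fun setT phi.
  apply: (@measurability _ _ (borelMx R d) (borelMx R d) setT phi (@open 'M[Cplx R]_d) erefl).
  move=> _ [B oB <-]; rewrite setTI; apply: sub_sigma_algebra.
  by move/continuousP: (@mulmxl_continuous _ _ _ d A); apply.
have GphiG : phi @^-1` G = G by apply/seteqP; split => U /GAU.
have key (g : 'M[Cplx R]_d -> R) : continuous g ->
    (\int[mu]_(U in G) g (A *m U) = \int[mu]_(U in G) g U)%R.
  move=> cg; rewrite /Rintegral; congr fine.
  transitivity (\int[pushforward mu phi]_(U in (G : set (borelMx R d))) (g U)%:E)%E.
    rewrite integral_pushforward // ?GphiG //; last exact: measurable_compact_borelMx.
      by apply/measurable_EFinP; exact: continuous_measurable_borelMx.
    apply: (@continuous_integrable_borelMx (fun U => g (A *m U))) => U.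
    by apply: continuous_comp; [exact: mulmxl_continuous|exact: cg].
  apply: eq_measure_integral => B mB _; exact: haar.2.
by rewrite /Cintegral; congr (_ +i* _); apply: (key (fun U => _ (f U))) => U;
  apply: continuous_comp; [exact: cf|exact: Re_continuous|exact: cf|exact: Im_continuous].
Qed.
End HaarIntegral.

(** A criterion covering all the groups below: averaging over the left translates by permutation
    matrices replaces the integrand by one that is constant on [G]. *)
Lemma quadrature_of_perm (R : realType) (d : nat) (G : set 'M[Cplx R]_d) :
  compact_unitary_subgroup G -> (forall t : 'S_d, G (perm_mx t)) ->
  quadrature_property G.
Proof.
move=> GG Gperm; split=> // mu haar k hk p; have [Gc GU _ GM GV] := GG.
pose F (t : 'S_d) (s : 'S_k) (U : 'M[Cplx R]_d) : Cplx R :=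
  \prod_(i < k) (U (t (widen_ord hk i)) (p i) * (U (t (widen_ord hk (s i))) (p i))^* ).
have cF t s : continuous (F t s).
  apply: continuous_prod => i _ U; apply: (cvgM (@coord_continuous _ _ _ _ _ U)).
  apply: (@continuous_comp _ _ _ (fun U : 'M[Cplx R]_d => U _ _) (fun z => z^* )).
    exact: coord_continuous.
  exact: conj_continuous.
(* Left multiplication by [perm_mx t] puts row [t i] in place of row [i], so by invariance the
   integral on the right is the same for every [t]. *)
have permE (t : 'S_d) : \sum_(s : 'S_k) (-1) ^+ s * Cintegral mu G (F 1%g s) =
    Cintegral mu G (fun U => alternating_product U p (fun i => t (widen_ord hk i))).
  rewrite Cintegral_sum //; last first.
    by move=> s U; exact: (cvgM (cvg_cst _) (cF t s U)).
  apply: eq_bigr => s _; rewrite (CintegralMsign Gc haar _ (cF t s)); congr (_ * _).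
  rewrite -(Cintegral_mulmxl Gc haar (cF 1%g s) (Gperm t)); last first.
    move=> U; split; last exact: GM (Gperm t).
    move=> /(GM _ _ (GV _ (Gperm t))); rewrite mulKmx //.
    exact: unitarymx_unit (GU _ (Gperm t)).
  apply: eq_Cintegral => U _; apply: eq_bigr => i _.
  by rewrite -row_permE !mxE !perm1.
have -> : \sum_(s : 'S_k) (-1) ^+ s * Cintegral mu G (fun U : 'M[Cplx R]_d =>
     \prod_(i < k) (U (widen_ord hk i) (p i) * (U (widen_ord hk (s i)) (p i))^* )) =
   \sum_(s : 'S_k) (-1) ^+ s * Cintegral mu G (F 1%g s).
  apply: eq_bigr => s _; congr (_ * _); apply: eq_Cintegral => U _.
  by apply: eq_bigr => i _; rewrite !perm1.
have [/injectiveP p_inj|/injectivePn[i [j ij pij]]] := boolP (injectiveb p); last first.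
  rewrite (permE 1%g) -[RHS](Cintegral_cst Gc haar); apply: eq_Cintegral => U _.
  exact: alternating_product_eq0_col ij pij.
have dF : d`!%:R != 0 :> Cplx R by rewrite pnatr_eq0 -lt0n fact_gt0.
apply: (mulIf dF); rewrite mulfVK // mulr_natr.
(* The [d!] copies of the signed sum are indexed by ['S_d], and the copy at [t] is rewritten with
   the rows moved by [t]. *)
have -> : d`! = #|{: 'S_d}| by rewrite card_Sn.
rewrite -sumr_const; under eq_bigr => t _ do rewrite (permE t).
rewrite -(Cintegral_sum Gc haar) => [|t]; last first.
  by apply: continuous_sum => s _ U; exact: (cvgM (cvg_cst _) (cF t s U)).
rewrite -[RHS](Cintegral_cst Gc haar); apply: eq_Cintegral => U /GU Uu.
exact: sum_perm_alternating_product.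
Qed.

(** * The groups *)

Section Groups.
Variables (R : realType) (d : nat).

(** Compactness is inherited from the unitary group, and inverses are conjugate transposes there. *)
Lemma compact_unitary_subgroup_closed (G : set 'M[Cplx R]_d) :
  closed G -> G `<=` unitary_group R d -> G 1%:M ->
  (forall U V, G U -> G V -> G (U *m V)) ->
  (forall U, G U -> G (U^t* )) -> compact_unitary_subgroup G.
Proof.
move=> Gcl GU G1 GM GV; split=> //.
  exact: subclosed_compact Gcl (@compact_unitary_group R d) GU.
by move=> U GUU; rewrite invmx_unitary; [exact: GV|exact: GU].
Qed.

Lemma quadrature_unitary_group : quadrature_property (unitary_group R d).
Proof.
apply: quadrature_of_perm => [|t]; last exact: perm_mx_unitary.
apply: compact_unitary_subgroup_closed.
- exact: closed_unitary_group.
- exact: subset_refl.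
- by apply/unitarymxP; rewrite trmx1 map_mx1 mulmx1.
- by move=> U V; exact: mul_unitarymx.
- by move=> U; rewrite /unitary_group /= trmxC_unitary.
Qed.

(** This form, unlike the image of a set of real matrices, shows that the group is closed. The real
    matrix is recovered by taking real parts, and its orthogonality by injectivity of the embedding
    of [R]. *)
Lemma orthogonal_groupE : orthogonal_group R d =
  unitary_group R d `&` [set U | forall i j, complex.Im (U i j : R[i]) = 0].
Proof.
have realE (A : 'M[R]_d) : (map_mx (real_complex R) A : 'M[Cplx R]_d)^t* =
    map_mx (real_complex R) A^T.
  by apply/matrixP => i j; rewrite !mxE [LHS]conjc_real.
apply/seteqP; split => [_ [A /= AA <-]|U [Uu /= U0]].
  split; last by move=> i j; rewrite mxE.
  by apply/unitarymxP; rewrite realE -[LHS](map_mxM (real_complex R)) AA map_mx1.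
pose A : 'M[R]_d := map_mx (fun z : Cplx R => complex.Re (z : R[i])) U.
have UA : U = map_mx (real_complex R) A.
  apply/matrixP => i j; rewrite !mxE; have := U0 i j.
  by case: (U i j) => a b /= ->.
exists A => //=.
have AA : map_mx (real_complex R : R -> Cplx R) (A *m A^T) = map_mx (real_complex R) 1%:M.
  by rewrite (map_mxM (real_complex R)) map_mx1 -realE -UA; exact/unitarymxP.
apply/matrixP => i j; apply: (@complexI R).
by have := congr1 (fun M : 'M[Cplx R]_d => M i j) AA; rewrite [LHS]mxE [RHS]mxE.
Qed.

Lemma quadrature_orthogonal_group : quadrature_property (orthogonal_group R d).
Proof.
have real_perm (t : 'S_d) : orthogonal_group R d (perm_mx t).
  exists (perm_mx t); last exact: map_perm_mx.
  by rewrite /= tr_perm_mx -perm_mxM mulgV perm_mx1.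
apply: quadrature_of_perm; last exact: real_perm.
apply: compact_unitary_subgroup_closed.
- rewrite orthogonal_groupE; apply: closedI; first exact: closed_unitary_group.
  rewrite [X in closed X](_ : _ = \bigcap_(ij in [set: 'I_d * 'I_d])
      (fun U : 'M[Cplx R]_d => complex.Im (U ij.1 ij.2 : R[i])) @^-1` [set 0]); last first.
    by apply/seteqP; split => [U U0 [i j] _|U U0 i j]; [exact: U0|exact: (U0 (i, j) I)].
  apply: closed_bigI => -[i j] _; apply: preimage_closed => [U _|]; last exact: closed_eq.
  apply: (@continuous_comp _ _ _ (fun U : 'M[Cplx R]_d => U i j)
    (fun z => complex.Im (z : R[i]))); first exact: coord_continuous.
  exact: Im_continuous.
- by rewrite orthogonal_groupE => U [].
- by rewrite -perm_mx1; exact: real_perm.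
- move=> _ _ [A /= AA <-] [B /= BB <-]; exists (A *m B).
    by rewrite /= trmx_mul mulmxA -(mulmxA A) BB mulmx1.
  exact: (map_mxM (real_complex R)).
- move=> _ [A /= AA <-]; exists A^T; first by rewrite /= trmxK; exact: mulmx1C.
  by apply/matrixP => i j; rewrite !mxE [RHS]conjc_real.
Qed.

(** With [t] fixed, membership becomes a condition on each entry separately, which suits closedness,
    products and conjugate transposes. The diagonal factor is read off as the entries
    [U i (t i)]. *)
Lemma hyperoctahedral_groupP s (U : 'M[Cplx R]_d) :
  hyperoctahedral_group R d s U <->
  exists (t : 'S_d), forall i j, 
    (t i = j -> roots_of_unity R s (U i j)) /\ (t i != j -> U i j = 0).
Proof.
split=> [[D [t [Dr ->]]]|[t Ut]].
  exists t => i j; rewrite mul_diag_mx !mxE; split => [<-|/negPf->].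
    by rewrite eqxx mulr1; exact: Dr.
  by rewrite mulr0.
exists (\row_i U i (t i)), t; split=> [j|].
  by rewrite mxE; exact: (Ut j (t j)).1.
apply/matrixP => i j; rewrite mul_diag_mx !mxE; case: eqP => [<-|/eqP tij].
  by rewrite mulr1.
by rewrite mulr0; exact: (Ut i j).2.
Qed.

Lemma closed_roots_of_unity s : closed (roots_of_unity R s).
Proof.
case: s => [n|] /=.
  apply: (@preimage_closed _ _ (fun z : Cplx R => z ^+ n) [set 1]); last exact: closed_set1.
  have -> : (fun z : Cplx R => z ^+ n) = (fun z => \prod_(i < n) z).
    by apply/funext => z; rewrite prodr_const card_ord.
  by move=> z _; apply: continuous_prod => i _ w; exact: cvg_id.
apply: (@preimage_closed _ _ (fun z : Cplx R => `|z|) [set 1]); last exact: closed_set1.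
move=> z _; exact: norm_continuous.
Qed.

(** The group is a finite union, over the permutations [t], of sets cut out by closed conditions on
    the entries. *)
Lemma closed_hyperoctahedral_group s : closed (hyperoctahedral_group R d s).
Proof.
have -> : hyperoctahedral_group R d s = \bigcup_(t in [set: 'S_d])
    \bigcap_(ij in [set: 'I_d * 'I_d]) (fun U : 'M[Cplx R]_d => U ij.1 ij.2) @^-1`
      (if t ij.1 == ij.2 then roots_of_unity R s else [set 0]).
  apply/seteqP; split => [U /hyperoctahedral_groupP[t Ut]|U [t _ Ut]].
    exists t => // -[i j] _ /=; case: eqP => [|/eqP] tij; first exact: (Ut i j).1.
    exact: (Ut i j).2.
  apply/hyperoctahedral_groupP; exists t => i j; have := Ut (i, j) I => /=.
  by case: eqP.
apply: closed_bigcup => [|t _]; first exact: finite_finset.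
apply: closed_bigI => -[i j] _; apply: preimage_closed => [U _|].
  exact: coord_continuous.
by case: ifP => _; [exact: closed_roots_of_unity|exact: closed_set1].
Qed.

(** The value [Some 0] is excluded because [z ^+ 0 = 1] holds for every [z], so the entries would
    not be forced to have modulus 1. *)
Lemma quadrature_hyperoctahedral_group s :
  s != Some 0 -> quadrature_property (hyperoctahedral_group R d s).
Proof.
move=> s0.
have rootM x y : roots_of_unity R s x -> roots_of_unity R s y -> roots_of_unity R s (x * y).
  case: (s) => [n|] /= x1 y1; first by rewrite exprMn x1 y1 mulr1.
  by rewrite normrM x1 y1 mulr1.
have rootJ x : roots_of_unity R s x -> roots_of_unity R s (x^* ).
  case: (s) => [n|] /= x1; first by rewrite -rmorphXn /= x1 rmorph1.
  by rewrite norm_conjC.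
have root1 : roots_of_unity R s 1.
  by case: (s) => [n|] /=; [rewrite expr1n|rewrite normr1].
have root_norm x : roots_of_unity R s x -> `|x| = 1.
  case: (s) s0 => [[|n]|] //= _ xn; apply/eqP.
  by rewrite -(@pexpr_eq1 _ _ n.+1) // -normrX xn normr1.
apply: quadrature_of_perm => [|t]; last first.
  exists (const_mx 1), t; split=> [j|]; first by rewrite mxE.
  by rewrite diag_const_mx mul1mx.
apply: compact_unitary_subgroup_closed.
- exact: closed_hyperoctahedral_group.
- move=> _ [D [t [Dr ->]]]; apply: mul_unitarymx; last exact: perm_mx_unitary.
  apply/unitarymxP; apply/matrixP => i j; rewrite mul_diag_mx !mxE.
  have [->|ij] := eqVneq i j; last first.
    by rewrite mulr0n rmorph0 mulr0.
  by rewrite mulr1n -normCK (root_norm _ (Dr j)) expr1n.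
- exists (const_mx 1), 1%g; split=> [j|]; first by rewrite mxE.
  by rewrite diag_const_mx mul1mx perm_mx1.
- move=> U V /hyperoctahedral_groupP[t Ut] /hyperoctahedral_groupP[u Vu].
  (* The only nonzero entry of row [i] of [U] is in column [t i], and [t * u] applies [t] first. *)
  apply/hyperoctahedral_groupP; exists (t * u)%g => i j.
  have -> : (U *m V) i j = U i (t i) * V (t i) j.
    rewrite mxE (bigD1 (t i)) //= big1 ?addr0 // => l lti.
    by rewrite (Ut i l).2 ?mul0r // eq_sym.
  rewrite permM; split => tij; last by rewrite (Vu (t i) j).2 ?mulr0.
  by apply: rootM; [exact: (Ut i (t i)).1|exact: (Vu (t i) j).1].
- move=> U /hyperoctahedral_groupP[t Ut]; apply/hyperoctahedral_groupP.
  (* Transposing the support of [U] inverts its permutation. *)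
  exists t^-1%g => i j; rewrite !mxE; split=> [<-|tij].
    by apply: rootJ; apply: (Ut _ i).1; rewrite permKV.
  rewrite (Ut j i).2 ?rmorph0 //; apply: contraNneq tij => <-.
  by rewrite permK.
Qed.
End Groups.

Theorem theorem1p4 (R : realType) (d : nat) (hd : (1 <= d)%N) :
  quadrature_property (unitary_group R d) /\
  quadrature_property (orthogonal_group R d) /\
  (forall s : nat, (2 <= s)%N ->
     quadrature_property (hyperoctahedral_group R d (Some s))) /\
  quadrature_property (hyperoctahedral_group R d None).
Proof.
split; first exact: quadrature_unitary_group.
split; first exact: quadrature_orthogonal_group.
split=> [s s2|]; apply: quadrature_hyperoctahedral_group => //.
by case: s s2.
Qed.
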